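(* Let $r_1\geq r_2\geq r_3\geq r_4$ be integers with $r_1+r_2+r_3+r_4=2l+1$ and let $so(2l+1)=\mathfrak{g}_e\oplus\mathfrak{g}_a\oplus\mathfrak{g}_b\oplus\mathfrak{g}_c$ be the $(\mathbb{Z}_2\times\mathbb{Z}_2)$-grading with $\mathfrak{g}_e=so(r_1)\oplus so(r_2)\oplus so(r_3)\oplus so(r_4)$ associated with the $(\mathbb{Z}_2\times\mathbb{Z}_2)$-symmetric space $SO(2l+1)/(SO(r_1)\times SO(r_2)\times SO(r_3)\times SO(r_4))$. If $r_4>2$, then every $\mathfrak{g}_e$-invariant inner product on $\mathfrak{m}=\mathfrak{g}_a\oplus\mathfrak{g}_b\oplus\mathfrak{g}_c$ is of the form $$B=t_{A_1}\sum(\alpha^1_{ij})^2+t_{A_2}\sum(\alpha^2_{ij})^2+t_{B_1}\sum(\beta^1_{ij})^2+t_{B_2}\sum(\beta^2_{ij})^2+t_{C_1}\sum(\gamma^1_{ij})^2+t_{C_2}\sum(\gamma^2_{ij})^2,$$ where $\{\alpha^1_{ij},\alpha^2_{ij},\beta^1_{ij},\beta^2_{ij},\gamma^1_{ij},\gamma^2_{ij}\}$ is the dual basis of the basis of $\mathfrak{m}=A_1\oplus A_2\oplus B_1\oplus B_2\oplus C_1\oplus C_2$ given by the elementary matrices, and the parameters $t_{A_1},t_{A_2},t_{B_1},t_{B_2},t_{C_1},t_{C_2}$ are positive real numbers.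
   Context: Decompose a matrix of $so(2l+1)$ into blocks of sizes $r_1,r_2,r_3,r_4$: $$\begin{pmatrix}X_1&A_1&B_1&C_1\\-{}^tA_1&X_2&C_2&B_2\\-{}^tB_1&-{}^tC_2&X_3&A_2\\-{}^tC_1&-{}^tB_2&-{}^tA_2&X_4\end{pmatrix},$$ with $X_i\in so(r_i)$, and $A_1,B_1,C_1,C_2,B_2,A_2$ arbitrary real matrices of sizes $r_1\times r_2$, $r_1\times r_3$, $r_1\times r_4$, $r_2\times r_3$, $r_2\times r_4$, $r_3\times r_4$ respectively. With $\mathbb{Z}_2\times\mathbb{Z}_2=\{e,a,b,c\}$, $\mathfrak{g}_e$ is the subspace of block diagonal matrices, $\mathfrak{g}_a$ the subspace where only the blocks $A_1,A_2$ (and their negative transposes) are nonzero, $\mathfrak{g}_b$ the one where only $B_1,B_2$ are nonzero, and $\mathfrak{g}_c$ the one where only $C_1,C_2$ are nonzero. The symbols $A_1,A_2,B_1,B_2,C_1,C_2$ also denote the subspaces of $so(2l+1)$ where only the corresponding block (and its negative transpose) is nonzero, so $\mathfrak{g}_a=A_1\oplus A_2$, $\mathfrak{g}_b=B_1\oplus B_2$, $\mathfrak{g}_c=C_1\oplus C_2$. The elementary matrices of such a subspace are those skew-symmetric matrices with entry $1$ at one position $(i,j)$ of the (upper) block, $-1$ at $(j,i)$, and $0$ elsewhere; together they form a basis of $\mathfrak{m}$, and each sum runs over all indices $(i,j)$ of the corresponding block. An inner product $B$ on $\mathfrak{m}$ is $\mathfrak{g}_e$-invariant if $B([X,Y],Z)+B(Y,[X,Z])=0$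 for $X\in\mathfrak{g}_e$, $Y,Z\in\mathfrak{m}$. Sums of squares of dual basis elements denote quadratic forms. *)

(* Defs.v *)
From HB Require Import structures.
From mathcomp Require Import all_boot all_order all_algebra reals.

Set Implicit Arguments.
Unset Strict Implicit.
Unset Printing Implicit Defensive.

Import Order.TTheory GRing.Theory Num.Theory.
Local Open Scope ring_scope.

Definition blk1 : 'I_4 := @Ordinal 4 0 isT.
Definition blk2 : 'I_4 := @Ordinal 4 1 isT.
Definition blk3 : 'I_4 := @Ordinal 4 2 isT.
Definition blk4 : 'I_4 := @Ordinal 4 3 isT.

Definition lie_bracket (R : fieldType) n (X Y : 'M[R]_n) : 'M[R]_n :=
  X *m Y - Y *m X.

Definition so (R : fieldType) n : {vspace 'M[R]_n} :=
  lker (linfun (fun X : 'M[R]_n => X + X^T)).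

Section Blocks.

Variables (R : fieldType) (r : 'I_4 -> nat).

Notation n := (\sum_k r k)%N.

Definition on_blocks (P : rel 'I_4) : {vspace 'M[R]_n} :=
  (\bigcap_(pq : 'I_4 * 'I_4 | ~~ P pq.1 pq.2)
     lker (linfun (fun X : 'M[R]_n => submxblock X pq.1 pq.2)))%VS.

Definition g_e : {vspace 'M[R]_n} := (so R n :&: on_blocks (fun p q => p == q))%VS.

Definition off_block (p q : 'I_4) : {vspace 'M[R]_n} :=
  (so R n :&:
   on_blocks (fun p' q' => ((p' == p) && (q' == q)) || ((p' == q) && (q' == p))))%VS.

Definition A1 := off_block blk1 blk2.
Definition A2 := off_block blk3 blk4.
Definition B1 := off_block blk1 blk3.
Definition B2 := off_block blk2 blk4.
Definition C1 := off_block blk1 blk4.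
Definition C2 := off_block blk2 blk3.

Definition g_a := (A1 + A2)%VS.
Definition g_b := (B1 + B2)%VS.
Definition g_c := (C1 + C2)%VS.

Definition mspace : {vspace 'M[R]_n} := (g_a + g_b + g_c)%VS.

(* [X, Y] lies in mspace (lie_bracket_mspace below), so vsproj is a mere cast. *)
Definition g_e_invariant (B : subvs_of mspace -> subvs_of mspace -> R) : Prop :=
  forall (X : 'M[R]_n) (Y Z : subvs_of mspace), X \in g_e ->
    B (vsproj mspace (lie_bracket X (vsval Y))) Z
    + B Y (vsproj mspace (lie_bracket X (vsval Z))) = 0.

Definition elem (s t : 'I_n) : 'M[R]_n := delta_mx s t - delta_mx t s.

(* tagnat.sig1 s is the block containing the position s. *)
Definition upper (s t : 'I_n) : bool := (tagnat.sig1 s < tagnat.sig1 t)%N.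

(* phi s t is the form dual to elem s t; for (s, t) outside the
   upper blocks it is unconstrained. *)
Definition dual_basis (phi : 'I_n -> 'I_n -> 'Hom(subvs_of mspace, R^o)) : Prop :=
  forall s t u v, upper s t -> upper u v ->
    phi s t (vsproj mspace (elem u v)) = ((s == u) && (t == v))%:R.

(* tagnat.Rank p i is the position of the i-th row (or column) of the block p. *)
Definition sum_sq (phi : 'I_n -> 'I_n -> 'Hom(subvs_of mspace, R^o))
    (p q : 'I_4) (X : subvs_of mspace) : R :=
  \sum_(i < r p) \sum_(j < r q)
    (phi (tagnat.Rank p i) (tagnat.Rank q j) X : R) ^+ 2.

Lemma mem_so n (X : 'M[R]_n) : (X \in so R n) = (X^T == - X).
Proof.
rewrite memv_ker -[linfun _]/(linfun (idfun \+ @trmx R n n)).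
by rewrite lfunE /= addrC addr_eq0.
Qed.

Lemma mem_on_blocks P (X : 'M[R]_n) :
  reflect (forall p q, ~~ P p q -> submxblock X p q = 0) (X \in on_blocks P).
Proof.
rewrite memvE; apply: (iffP subv_bigcapP) => [H p q Ppq | H [p q] Ppq].
  have := H (p, q) Ppq; rewrite -memvE memv_ker.
  rewrite -[linfun _]/(linfun (mxsub (@tagnat.Rank _ r p) (@tagnat.Rank _ r q))).
  by rewrite lfunE => /eqP.
rewrite -memvE memv_ker.
rewrite -[linfun _]/(linfun (mxsub (@tagnat.Rank _ r p) (@tagnat.Rank _ r q))).
by rewrite lfunE /=; apply/eqP/H.
Qed.

Lemma mem_on_blocksE P (X : 'M[R]_n) :
  reflect (forall s t, ~~ P (tagnat.sig1 s) (tagnat.sig1 t) -> X s t = 0)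
          (X \in on_blocks P).
Proof.
apply: (iffP (mem_on_blocks _ _)) => [H s t Pst | H p q Ppq].
  have /matrixP/(_ (tagnat.sig2 s) (tagnat.sig2 t)) := H _ _ Pst.
  by rewrite !mxE !tagnat.sig2K.
by apply/matrixP=> i j; rewrite !mxE H // !tagnat.Rank1K.
Qed.

Lemma sum_pick (V : nmodType) k (P : rel 'I_k) (F : 'I_k -> 'I_k -> V) s t :
  P s t -> (forall u v, P u v -> (s == u) && (t == v) = false -> F u v = 0) ->
  \sum_u \sum_(v | P u v) F u v = F s t.
Proof.
move=> st H; rewrite (bigD1 s) //= (bigD1 t) //= !big1 ?addr0 // => [u us|v /andP[uv vt]].
  by apply: big1 => v uv; apply: H => //; rewrite eq_sym (negbTE us).
by apply: H => //; rewrite (eq_sym t) (negbTE vt) andbF.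
Qed.

Notation bl := (@tagnat.sig1 _ r).

Lemma mem_entries P (X : 'M[R]_n) :
  reflect ((forall s t, X t s = - X s t) /\
           (forall s t, ~~ P (bl s) (bl t) -> X s t = 0))
          (X \in (so R n :&: on_blocks P)%VS).
Proof.
rewrite memv_cap mem_so; apply: (iffP andP) => -[H1 H2]; split.
- by move=> s t; have /matrixP/(_ s t) := eqP H1; rewrite !mxE.
- exact/mem_on_blocksE.
- by apply/eqP/matrixP=> s t; rewrite !mxE H1.
- exact/mem_on_blocksE.
Qed.

Lemma mspaceE : mspace = (so R n :&: on_blocks (fun p q => p != q))%VS.
Proof.
apply/eqP; rewrite eqEsubv; apply/andP; split.
  have sub p q : p != q -> (off_block p q <= so R n :&: on_blocks (fun p q => p != q))%VS.
    move=> pq; apply/subvP=> X /mem_entries[H1 H2]; apply/mem_entries; split=> //.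
    move=> s t /negPn/eqP E; apply: H2; rewrite E; apply: contra pq.
    by case/orP=> /andP[/eqP <- /eqP <-].
  by rewrite /mspace /g_a /g_b /g_c !subv_add !sub.
apply/subvP=> X /mem_entries[H1 H2].
pose pr p q : 'M[R]_n := \matrix_(s, t)
  (if ((bl s == p) && (bl t == q)) || ((bl s == q) && (bl t == p)) then X s t else 0).
have prin p q : pr p q \in off_block p q.
  apply/mem_entries; split=> s t; rewrite !mxE.
    by rewrite orbC ![(bl t == _) && _]andbC; case: ifP => _ //; rewrite oppr0.
  by move=> /negbTE->.
have -> : X = pr blk1 blk2 + pr blk3 blk4 + (pr blk1 blk3 + pr blk2 blk4)
              + (pr blk1 blk4 + pr blk2 blk3).
  apply/matrixP=> s t; rewrite !mxE.
  have := H2 s t.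
  case: (bl s) => -[|[|[|[|//]]]] ?; case: (bl t) => -[|[|[|[|//]]]] ?;
  rewrite -!val_eqE /= => H; rewrite ?addr0 ?add0r //; exact: H.
by rewrite !memv_add // prin.
Qed.

Lemma grading_sum : (g_e + mspace)%VS = so R n.
Proof.
rewrite mspaceE; apply/eqP; rewrite eqEsubv subv_add !capvSl /=.
apply/subvP=> X; rewrite mem_so => /eqP/matrixP XT.
have H1 s t : X t s = - X s t by have := XT s t; rewrite !mxE.
pose D : 'M[R]_n := \matrix_(s, t) (if bl s == bl t then X s t else 0).
rewrite -(subrK D X) addrC memv_add //; apply/mem_entries; split=> s t; rewrite !mxE.
- by rewrite eq_sym H1; case: ifP; rewrite ?oppr0.
- by move=> /negbTE->.
- by rewrite eq_sym H1; case: ifP => _; rewrite ?subrr ?subr0 ?oppr0.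
- by move/negPn=> /eqP->; rewrite eqxx subrr.
Qed.

Lemma grading_cap : (g_e :&: mspace)%VS = 0%VS.
Proof.
rewrite mspaceE; apply/eqP; rewrite -subv0; apply/subvP=> X.
rewrite memv_cap memv0 => /andP[/mem_entries[_ H] /mem_entries[_ K]].
apply/eqP/matrixP=> s t; rewrite mxE.
by case: (boolP (bl s == bl t)) => E; [apply: K; rewrite E | apply: H].
Qed.

Lemma lie_bracket_mspace (X Y : 'M[R]_n) :
  X \in g_e -> Y \in mspace -> lie_bracket X Y \in mspace.
Proof.
rewrite mspaceE => /mem_entries[X1 X2] /mem_entries[Y1 Y2].
apply/mem_entries; split=> s t; rewrite !mxE.
  rewrite opprB; congr (_ - _); apply: eq_bigr => k _.
    by rewrite X1 Y1 mulrNN mulrC.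
  by rewrite X1 Y1 mulrNN mulrC.
move/negPn/eqP=> E; rewrite !big1 ?subr0 // => k _.
  case: (boolP (bl k == bl t)) => F; last by rewrite X2 ?mulr0.
  by rewrite Y2 ?mul0r // negbK E (eqP F).
case: (boolP (bl s == bl k)) => F; last by rewrite X2 ?mul0r.
by rewrite Y2 ?mulr0 // negbK -E (eqP F).
Qed.

Lemma elem_mspace (s t : 'I_n) : upper s t -> elem s t \in mspace.
Proof.
rewrite mspaceE => st; apply/mem_entries; split=> u v; rewrite !mxE.
  by rewrite opprB ![(v == _) && _]andbC.
move/negPn/eqP=> E.
case: (boolP ((u == s) && (v == t))) => [/andP[/eqP us /eqP vt]|_].
  by move: st; rewrite /upper -us -vt E ltnn.
case: (boolP ((u == t) && (v == s))) => [/andP[/eqP us /eqP vt]|_].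
  by move: st; rewrite /upper -us -vt E ltnn.
by rewrite subrr.
Qed.

Lemma dual_basis_entries (phi : 'I_n -> 'I_n -> 'Hom(subvs_of mspace, R^o)) :
  dual_basis phi <-> forall s t X, upper s t -> phi s t X = vsval X s t.
Proof.
have E s t u v : upper s t -> upper u v ->
    elem u v s t = ((s == u) && (t == v))%:R.
  move=> st uv; rewrite !mxE.
  case: (boolP ((s == v) && (t == u))) => [/andP[/eqP sv /eqP tu]|_].
    by move: st uv; rewrite /upper sv tu => /ltn_trans h /h; rewrite ltnn.
  by rewrite subr0.
split=> [H s t X st|H s t u v st uv]; last first.
  by rewrite H // vsprojK ?elem_mspace // E.
have XE : X = \sum_u \sum_(v | upper u v) vsval X u v *: vsproj mspace (elem u v).
  have sub Y : Y \in mspace -> Y \in (so R n :&: on_blocks (fun p q => p != q))%VS.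
    by rewrite -mspaceE.
  have /mem_entries[X1 X2] := sub _ (subvsP X).
  apply/val_inj/matrixP=> a b /=.
  transitivity (\sum_u \sum_(v | upper u v) vsval X u v *
      (((a == u) && (b == v))%:R - ((a == v) && (b == u))%:R)); last first.
    symmetry; rewrite raddf_sum summxE; apply: eq_bigr => u _.
    rewrite raddf_sum summxE; apply: eq_bigr => v uv.
    by rewrite /= vsprojK ?elem_mspace // !mxE.
  have K : forall a b, upper a b -> vsval X a b = 
    \sum_u \sum_(v | upper u v) vsval X u v * 
      (((a == u) && (b == v))%:R - ((a == v) && (b == u))%:R).
    move=> c d cd; rewrite (sum_pick cd) => [|u v uv cdN].
      by have := E c d c d cd cd; rewrite !mxE => ->; rewrite !eqxx mulr1.
    by have := E c d u v cd uv; rewrite !mxE cdN => ->; rewrite mulr0.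
  case: (ltngtP (bl a) (bl b)) => ab; first exact: K.
    rewrite X1 (K b a) // -sumrN; apply: eq_bigr=> u _.
    rewrite -sumrN; apply: eq_bigr=> v _.
    by rewrite -mulrN opprB ![(a == _) && _]andbC.
  rewrite X2; last by rewrite negbK; apply/eqP/val_inj.
  symmetry; apply: big1=> u _; apply: big1 => v uv.
  have N c d : bl c = bl d :> nat -> (c == u) && (d == v) = false.
    by move=> cd; apply/negP=> /andP[/eqP cu /eqP dv];
      move: uv; rewrite /upper -cu -dv cd ltnn.
  by rewrite N // andbC N // subrr mulr0.
transitivity (\sum_u \sum_(v | upper u v)
    phi s t (vsval X u v *: vsproj mspace (elem u v))).
  by rewrite {1}XE raddf_sum; apply: eq_bigr => u _; rewrite raddf_sum.
rewrite (sum_pick st) => [|u v uv stN]; rewrite linearZ /= H // ?stN ?scaler0 //.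
by rewrite !eqxx /GRing.scale /= mulr1.
Qed.

Lemma ex_dual_basis : exists phi, dual_basis phi.
Proof.
exists (fun s t => linfun (fun X : subvs_of mspace => vsval X s t : R^o)).
apply/dual_basis_entries => s t X _.
pose f := fun X : subvs_of mspace => vsval X s t : R^o.
have fl : linear f by move=> a Y Z; rewrite /f !mxE.
pose F := HB.pack_for {linear subvs_of mspace -> R^o} f
  (GRing.isLinear.Build R _ _ _ f fl).
by rewrite -[linfun _]/(linfun F) lfunE.
Qed.

End Blocks.

(* Main.v *)
Require Import Defs.
From HB Require Import structures.
From mathcomp Require Import all_boot all_order all_algebra reals ring.

Set Implicit Arguments.
Unset Strict Implicit.
Unset Printing Implicit Defensive.

Import Order.TTheory GRing.Theory Num.Theory.
Local Open Scope ring_scope.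

(* Fix distinct indices s, a of one block and X = E_sa in g_e. Then
   [X, E_at] = E_st and [X, E_st] = - E_at, while X kills E_uv whenever
   s and a are not in {u, v}. As every block has at least three indices, a can
   be chosen so that invariance under X gives B(E_st, E_uv) = 0 as soon as s is
   not in {u, v}; so the elementary matrices are orthogonal for B. Invariance on
   the pair (E_at, E_st) gives B(E_st, E_st) = B(E_at, E_at), so B(E_st, E_st)
   depends only on the blocks of s and t. *)

Section InvariantForms.

Variables (R : numFieldType) (r : 'I_4 -> nat).

Notation n := (\sum_k r k)%N.
Notation bl := (@tagnat.sig1 _ r).
Notation m := (mspace R r).
Notation ev s t := (vsproj m (elem R s t)).

Implicit Types s t u v a : 'I_n.

Lemma elem_antisym s t : elem R t s = - elem R s t.
Proof. by rewrite /elem opprB. Qed.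

Lemma vsproj_elem_antisym s t : ev s t = - ev t s.
Proof. by rewrite elem_antisym linearN. Qed.

Lemma upper_neq s t : upper s t -> bl s != bl t.
Proof. by apply: contraTneq => E; rewrite /upper E ltnn. Qed.

Lemma lie_bracket_elem s a t : s != a -> t != s -> t != a ->
  lie_bracket (elem R s a) (elem R a t) = elem R s t.
Proof.
move=> sa ts ta; rewrite /lie_bracket /elem !(mulmxBl, mulmxBr).
rewrite !mul_delta_mx_cond !(eq_sym a) eqxx (eq_sym s t).
by rewrite (negbTE sa) (negbTE ts) (negbTE ta) !mulr0n mulr1n !subr0 !sub0r opprK.
Qed.

Lemma lie_bracket_elem0 s a u v :
  s != u -> s != v -> a != u -> a != v ->
  lie_bracket (elem R s a) (elem R u v) = 0.
Proof.
move=> su sv au av; rewrite /lie_bracket /elem !(mulmxBl, mulmxBr).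
rewrite !mul_delta_mx_cond !(eq_sym u) !(eq_sym v).
by rewrite (negbTE su) (negbTE sv) (negbTE au) (negbTE av) !mulr0n !subrr.
Qed.

Lemma elem_g_e s a : bl s = bl a -> elem R s a \in g_e R r.
Proof.
move=> sa; apply/mem_entries; split=> u v; rewrite !mxE.
  by rewrite opprB ![(v == _) && _]andbC.
move=> uv; case: (boolP ((u == s) && (v == a))) => [/andP[/eqP E /eqP F]|_].
  by move: uv; rewrite E F sa eqxx.
case: (boolP ((u == a) && (v == s))) => [/andP[/eqP E /eqP F]|_].
  by move: uv; rewrite E F sa eqxx.
by rewrite subrr.
Qed.

Lemma elem_mspace_neq s t : bl s != bl t -> elem R s t \in m.
Proof.
rewrite -val_eqE neq_ltn => /orP[] st; first exact: elem_mspace.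
by rewrite elem_antisym memvN elem_mspace.
Qed.

(** A block of at least three positions does not fit in [[set s; w]], which has at most two
    elements; [w] may be any position, even [s] itself. *)
Lemma ex_third_index s w : (2 < r (bl s))%N ->
  exists a, [/\ bl a = bl s, a != s & a != w].
Proof.
move=> r2; pose rk x := @tagnat.Rank _ r (bl s) x.
have : ~~ ([set rk x | x in [set: 'I_(r (bl s))]] \subset [set s; w]).
  apply: contraL r2 => /subset_leq_card.
  rewrite card_imset; last by move=> x y /tagnat.rank_inj/eqP; rewrite eq_Tagged => /eqP.
  rewrite cardsT card_ord cards2 -leqNgt => /leq_trans; apply.
  by case: (_ != _).
case/subsetPn=> a /imsetP[x _ ax]; rewrite !inE negb_or => /andP[as_ aw].
by exists a; rewrite ax tagnat.Rank1K -ax.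
Qed.

Lemma mspace_entries_inj (X Y : subvs_of m) :
  (forall s t, upper s t -> vsval X s t = vsval Y s t) -> X = Y.
Proof.
have sub (Z : subvs_of m) :
    vsval Z \in (so R n :&: on_blocks R r (fun p q => p != q))%VS.
  by rewrite -mspaceE subvsP.
move=> XY; apply/val_inj/matrixP=> s t /=.
have /mem_entries[X1 X2] := sub X; have /mem_entries[Y1 Y2] := sub Y.
case: (ltngtP (bl s) (bl t)) => [/XY //|ts|st].
  by rewrite X1 Y1 XY.
by rewrite X2 ?Y2 // negbK; apply/eqP/val_inj.
Qed.

(** An element of [m] is determined by its upper entries, and these are its values under the
    [phi s t]; applying [phi s t] to the sum leaves one term by duality. *)
Lemma dual_basis_decomp (phi : 'I_n -> 'I_n -> 'Hom(subvs_of m, R^o))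
    (X : subvs_of m) : dual_basis phi ->
  X = \sum_s \sum_(t | upper s t) (phi s t X : R) *: ev s t.
Proof.
move=> dphi; have /dual_basis_entries phiE := dphi.
apply: mspace_entries_inj => s t st; rewrite -!phiE // linear_sum.
under [RHS]eq_bigr do rewrite linear_sum.
rewrite (sum_pick st) => [|u v uv stN]; rewrite linearZ /= dphi ?stN ?scaler0 //.
by rewrite !eqxx /GRing.scale /= mulr1.
Qed.

Lemma big_blocks (V : nmodType) (F : 'I_n -> 'I_n -> V) :
  \sum_s \sum_(t | upper s t) F s t =
  \sum_(p : 'I_4) \sum_(q : 'I_4 | (p < q)%N) \sum_(i < r p) \sum_(j < r q)
    F (tagnat.Rank p i) (tagnat.Rank q j).
Proof.
have part (G : 'I_n -> V) (P : pred 'I_4) :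
    \sum_(s | P (bl s)) G s =
    \sum_(p | P p) \sum_(i < r p) G (tagnat.Rank p i).
  (* Positions correspond bijectively to pairs of a block and an index inside it. *)
  rewrite [RHS]sig_big_dep /= [RHS](reindex _ (onW_bij _ (@tagnat.sig_bij _ r))) /=.
  by apply: eq_big => s; rewrite ?andbT // => _; rewrite tagnat.sig2K.
rewrite (part _ xpredT); apply: eq_bigr => p _.
rewrite exchange_big /=; apply: eq_bigr => i _.
by rewrite -part; apply: eq_bigl => t; rewrite /upper tagnat.Rank1K.
Qed.

Variable B : {dot subvs_of m for idfun}.
Hypothesis B_inv : g_e_invariant B.
Hypothesis r_gt2 : forall p, (2 < r p)%N.

Lemma form_elem_ortho s t u v : bl s != bl t -> bl u != bl v ->
  s != u -> s != v -> B (ev s t) (ev u v) = 0.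
Proof.
move=> st uv su sv.
(* At most one of [u], [v] lies in the block of [s], because their blocks differ. If [u] does, [a]
   only has to avoid [u]; otherwise it only has to avoid [v]. *)
have [a [as_ ans aw]] := ex_third_index (if bl u == bl s then u else v) (r_gt2 (bl s)).
have [au av] : a != u /\ a != v.
  move: aw; case: (altP (bl u =P bl s)) => us aw; split=> //.
    by apply: contra uv => /eqP <-; rewrite as_ us.
  by apply: contra us => /eqP <-; rewrite as_.
have at_ : bl a != bl t by rewrite as_.
have ts : t != s by apply: contra st => /eqP ->.
have ta : t != a by apply: contra at_ => /eqP ->.
have := B_inv (ev a t) (ev u v) (elem_g_e (esym as_)).
rewrite !vsprojK ?elem_mspace_neq // lie_bracket_elem // 1?eq_sym //.
by rewrite lie_bracket_elem0 // !linear0 addr0.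
Qed.

(** Two distinct upper pairs share at most one position, so [s] or [t] lies outside [{u, v}]. In the
    second case [elem R s t] is replaced by [- elem R t s]. *)
Lemma form_upper_ortho s t u v : upper s t -> upper u v ->
  ~~ ((s == u) && (t == v)) -> B (ev s t) (ev u v) = 0.
Proof.
move=> st uv; have [st' uv'] := (upper_neq st, upper_neq uv).
have [su|su] := eqVneq s u => /= stN; last first.
  have [sv|sv] := eqVneq s v; last exact: form_elem_ortho.
  have [tu|tu] := eqVneq t u.
    by move: st uv; rewrite /upper sv tu => /ltn_trans h /h; rewrite ltnn.
  rewrite vsproj_elem_antisym linearNl /= form_elem_ortho ?oppr0 //.
    by rewrite eq_sym.
  by rewrite -sv; apply: contra st' => /eqP ->.
rewrite vsproj_elem_antisym linearNl /= form_elem_ortho ?oppr0 //.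
  by rewrite eq_sym.
by rewrite -su; apply: contra st' => /eqP ->.
Qed.

Lemma form_elem_eq s a t : bl s = bl a -> bl s != bl t ->
  B (ev s t) (ev s t) = B (ev a t) (ev a t).
Proof.
move=> sa st; have [<-//|s_a] := eqVneq s a.
have at_ : bl a != bl t by rewrite -sa.
have ts : t != s by apply: contra st => /eqP ->.
have ta : t != a by apply: contra at_ => /eqP ->.
have := B_inv (ev a t) (ev s t) (elem_g_e sa).
rewrite !vsprojK ?elem_mspace_neq // lie_bracket_elem //.
(* This is [[E_as, E_st] = E_at] with the sign of [E_as = - E_sa] moved out. *)
have -> : lie_bracket (elem R s a) (elem R s t) = - elem R a t.
  rewrite -(@lie_bracket_elem a s t) // 1?eq_sym // (elem_antisym a s).
  by rewrite /lie_bracket mulNmx mulmxN opprD.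
by rewrite !linearN /= => /eqP; rewrite subr_eq0 => /eqP.
Qed.

(** Move the first index inside its block, transpose both elementary matrices, and move the other
    index; the signs cancel in pairs. *)
Lemma form_elem_block s t u v : bl s = bl u -> bl t = bl v -> bl s != bl t ->
  B (ev s t) (ev s t) = B (ev u v) (ev u v).
Proof.
move=> su tv st; have ut : bl u != bl t by rewrite -su.
rewrite (form_elem_eq su st) (vsproj_elem_antisym u) (vsproj_elem_antisym u v).
by rewrite !linearNl !linearNr /= (form_elem_eq tv) // eq_sym.
Qed.

(** Positive definiteness enters here: [elem R s t] is nonzero, its entry at [(s, t)] being 1. *)
Lemma form_elem_gt0 s t : bl s != bl t -> 0 < B (ev s t) (ev s t).
Proof.
move=> st; apply: neq0_dnorm_gt0; apply/negP=> /eqP /(congr1 vsval).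
rewrite vsprojK ?elem_mspace_neq // => /matrixP/(_ s t)/eqP.
rewrite !mxE !eqxx; have [E|_] := eqVneq s t; first by rewrite E eqxx in st.
by rewrite subr0 oner_eq0.
Qed.

Lemma form_diag (phi : 'I_n -> 'I_n -> 'Hom(subvs_of m, R^o))
    (X : subvs_of m) : dual_basis phi ->
  B X X = \sum_s \sum_(t | upper s t) (phi s t X : R) ^+ 2 * B (ev s t) (ev s t).
Proof.
move=> dphi; rewrite {1}(dual_basis_decomp X dphi) linear_sumlz.
apply: eq_bigr => s _; rewrite linear_sumlz; apply: eq_bigr => t st.
rewrite linearZl_LR /= expr2 -mulrA; congr (_ * _).
(* The first argument is already expanded; now the second one is, and orthogonality keeps only the
   term of [(s, t)]. *)
rewrite {1}(dual_basis_decomp X dphi) linear_sumr.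
under [LHS]eq_bigr do rewrite linear_sumr.
rewrite (sum_pick st) => [|u v uv]; rewrite linearZr_LR //=.
by move/negbT=> uvN; rewrite form_upper_ortho ?mulr0 ?uvN.
Qed.

Lemma form_blocks : exists c : 'I_4 -> 'I_4 -> R,
  (forall p q, p != q -> 0 < c p q) /\
  forall phi (X : subvs_of m), dual_basis phi ->
    B X X = \sum_(p : 'I_4) \sum_(q : 'I_4 | (p < q)%N) c p q * sum_sq phi p q X.
Proof.
(* [i0 p] is the first position of block [p]. By [form_elem_block] any other representative gives
   the same coefficient [c p q]. *)
pose i0 p : 'I_n := tagnat.Rank p (Ordinal (ltnW (ltnW (r_gt2 p)))).
exists (fun p q => B (ev (i0 p) (i0 q)) (ev (i0 p) (i0 q))); split=> [p q pq|phi X dphi].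
  by apply: form_elem_gt0; rewrite !tagnat.Rank1K.
rewrite (form_diag X dphi) big_blocks.
apply: eq_bigr => p _; apply: eq_bigr => q pq.
rewrite /sum_sq mulr_sumr; apply: eq_bigr => i _.
rewrite mulr_sumr; apply: eq_bigr => j _; rewrite mulrC; congr (_ * _).
apply: form_elem_block; rewrite !tagnat.Rank1K //.
by apply: contraTneq pq => ->; rewrite ltnn.
Qed.

End InvariantForms.

Theorem proposition9 (R : realType) (l : nat) (r : 'I_4 -> nat)
  (r12 : (r blk2 <= r blk1)%N) (r23 : (r blk3 <= r blk2)%N)
  (r34 : (r blk4 <= r blk3)%N)
  (r_sum : (r blk1 + r blk2 + r blk3 + r blk4 = 2 * l + 1)%N)
  (r4_gt2 : (2 < r blk4)%N)
  (B : {dot subvs_of (mspace R r) for idfun})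
  (B_inv : g_e_invariant B)
  (phi : 'I_(\sum_k r k) -> 'I_(\sum_k r k) -> 'Hom(subvs_of (mspace R r), R^o))
  (phi_dual : dual_basis phi) :
  exists tA1 tA2 tB1 tB2 tC1 tC2 : R,
    [/\ 0 < tA1, 0 < tA2 & 0 < tB1] /\ [/\ 0 < tB2, 0 < tC1 & 0 < tC2] /\
    forall X : subvs_of (mspace R r),
      B X X = tA1 * sum_sq phi blk1 blk2 X + tA2 * sum_sq phi blk3 blk4 X
            + tB1 * sum_sq phi blk1 blk3 X + tB2 * sum_sq phi blk2 blk4 X
            + tC1 * sum_sq phi blk1 blk4 X + tC2 * sum_sq phi blk2 blk3 X.
Proof.
have r_gt2 p : (2 < r p)%N.
  have r3 := leq_trans r4_gt2 r34; have r2 := leq_trans r3 r23.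
  have r1 := leq_trans r2 r12.
  case: p => -[|[|[|[|//]]]] ip;
    [move: r1 | move: r2 | move: r3 | move: r4_gt2];
    by congr (_ < r _)%N; apply: val_inj.
have [c [c_gt0 Bc]] := form_blocks B_inv r_gt2.
exists (c blk1 blk2), (c blk3 blk4), (c blk1 blk3), (c blk2 blk4),
  (c blk1 blk4), (c blk2 blk3).
split; first by split; apply: c_gt0.
split=> [|X]; first by split; apply: c_gt0.
rewrite (Bc _ _ phi_dual).
(* Turning the condition [p < q] into a conditional lets the sum over ['I_4] be expanded to its six
   nonzero terms. *)
under [LHS]eq_bigr do rewrite big_mkcond.
rewrite !big_ord_recl !big_ord0 /=.
(* The most nested index comes first, since it contains the others as subterms. *)
have -> : lift ord0 (lift ord0 (lift ord0 ord0)) = blk4 by apply: val_inj.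
have -> : lift ord0 (lift ord0 ord0) = blk3 by apply: val_inj.
have -> : lift ord0 ord0 = blk2 by apply: val_inj.
have -> : ord0 = blk1 by apply: val_inj.
ring.
Qed.
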